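(* Let $V=\coprod_{n\ge t}V_{(n)}$ be a lower truncated $\mathbb{Z}$-graded vertex algebra for some $t\in\mathbb{Z}$, let $g$ be an automorphism of $V$ with period $T$, and let $W=\bigoplus_{n\in\frac1T\mathbb{N}}W_{(n)}$ be a $\frac1T\mathbb{N}$-graded $g$-twisted $V$-module. Then $$C_n^T(W)\subset\coprod_{k\ge n+t-\frac{2T-1}{T}}W_{(k)}\quad\text{for } n\ge2.$$ Furthermore, for $n\ge2$, we have $$\bigcap_{n\ge0}E_n^T(W)=\bigcap_{n\ge2}C_n^T(W)=0,$$ $$E_m^T(W)\subset\coprod_{k\ge n+t-\frac{2T-1}{T}}W_{(k)}\quad\text{for } m\ge (n-2)T(T+1)2^{n-2}T.$$
   Context: $\mathbb{N}$ is the set of nonnegative integers. Vertex algebras are over $\mathbb{C}$; a vertex algebra $V$ has vertex operators $Y(v,x)=\sum_{n\in\mathbb{Z}}v_nx^{-n-1}$ ($v_n\in\mathrm{End}\,V$) and vacuum $\mathbf{1}$. An automorphism of $V$ is a linear isomorphism $g$ with $gY(v,x)g^{-1}=Y(g(v),x)$ for all $v\in V$; it has period $T$ ($T$ a positive integer) if $g^T=1$. Then $V=\bigoplus_{r=0}^{T-1}V^r$ with $V^r=\{v\in V: g(v)=e^{2\pi i r/T}v\}$. A $g$-twisted $V$-module is a vector space $W$ with a linear map $Y_W(\cdot,x):V\to(\mathrm{End}\,W)[[x^{1/T},x^{-1/T}]]$, $Y_W(v,x)=\sum_{n\in\frac1T\mathbb{Z}}v_nx^{-n-1}$, such that for $u\in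 V^r$ ($0\le r\le T-1$), $v\in V$, $w\in W$: $Y_W(u,x)=\sum_{n\in\frac rT+\mathbb{Z}}u_nx^{-n-1}$; $u_nw=0$ for $n\in\frac rT+\mathbb{Z}$ sufficiently large; $Y_W(\mathbf{1},x)=\mathrm{Id}_W$; and $$x_0^{-1}\delta\left(\tfrac{x_1-x_2}{x_0}\right)Y_W(u,x_1)Y_W(v,x_2)w-x_0^{-1}\delta\left(\tfrac{x_2-x_1}{-x_0}\right)Y_W(v,x_2)Y_W(u,x_1)w=x_2^{-1}\left(\tfrac{x_1-x_0}{x_2}\right)^{-\frac rT}\delta\left(\tfrac{x_1-x_0}{x_2}\right)Y_W(Y(u,x_0)v,x_2)w,$$ where $\delta(x)=\sum_{n\in\mathbb{Z}}x^n$ and binomials are expanded in nonnegative integral powers of the second variable. A $\mathbb{Z}$-graded vertex algebra is a vertex algebra with a grading $V=\coprod_{n\in\mathbb{Z}}V_{(n)}$ such that $\mathbf{1}\in V_{(0)}$ and $u_mV_{(n)}\subset V_{(n+k-m-1)}$ for $u\in V_{(k)}$, $k,m,n\in\mathbb{Z}$; it is lower truncated if $V_{(n)}=0$ for $n$ sufficiently small. A $\frac1T\mathbb{N}$-graded $g$-twisted $V$-module is a $g$-twisted $V$-module with a grading $W=\bigoplus_{n\in\frac1T\mathbb{N}}W_{(n)}$ such that $v_mW_{(n)}\subseteq W_{(n+k-m-1)}$ for $v\in V_{(k)}$, $k\in\mathbb{Z}$, $m\in\frac1T\mathbb{Z}$, $n\in\frac1T\mathbb{N}$. $E_n^T(W)$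 ($n\in\mathbb{Z}$) is the linear span of all $u^{(1)}_{-1-k_1+\frac{r_1}{T}}\cdots u^{(s)}_{-1-k_s+\frac{r_s}{T}}w$ with $s\ge1$, $u^{(i)}\in V^{r_i}$, $0\le r_i\le T-1$, $w\in W$, $k_i\ge0$, $k_1+\cdots+k_s-\frac{r_1+\cdots+r_s}{T}\ge\frac nT$. For $n\ge2$, $C_n^T(W)=\mathrm{span}\{u_{-n+\frac pT}w: u\in V^p,\ w\in W,\ p=0,1,\dots,T-1\}$.
   Formalization: In the last inclusion m > 0 is also required; this excludes only n = 2, m = 0, where the printed claim fails: E_0(W) = W always, and for V = W = W_(0) = ℂ, T = 1, t = 0 the right-hand side is 0. *)

(* Defs.v *)
From HB Require Import structures.
From mathcomp Require Import all_boot all_order all_algebra.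
From mathcomp Require Import all_classical all_reals all_analysis.
From mathcomp Require Import complex.

Set Implicit Arguments.
Unset Strict Implicit.
Unset Printing Implicit Defensive.

Import Order.TTheory GRing.Theory Num.Theory.

Local Open Scope classical_set_scope.
Local Open Scope complex_scope.
Local Open Scope ring_scope.

Section LinearAlgebra.
Variables (K : nzRingType) (M : lmodType K).

Definition linspan (S : set M) : set M :=
  [set w | exists s : seq (K * M),
    (forall p, p \in s -> S p.2) /\ w = \sum_(p <- s) p.1 *: p.2].

Definition is_subspace (A : set M) : Prop :=
  A 0 /\ forall (a : K) (u v : M), A u -> A v -> A (a *: u + v).

(* The sum of the subspaces [A i], [i \in D], inside [M].  When the [A i] are
   the homogeneous subspaces of a grading, this is the coproduct
   \coprod_(i in D) A i seen as a subspace of [M]. *)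
Definition coprod (I : choiceType) (D : set I) (A : I -> set M) : set M :=
  [set w | exists (s : seq I) (f : I -> M),
    [/\ uniq s, forall i, i \in s -> D i /\ A i (f i)
      & w = \sum_(i <- s) f i]].

Record direct_sum (I : choiceType) (A : I -> set M) : Prop := DirectSum {
  direct_sum_subspace : forall i, is_subspace (A i);
  direct_sum_span : coprod setT A = setT;
  direct_sum_indep : forall (s : seq I) (f : I -> M), uniq s ->
    (forall i, i \in s -> A i (f i)) -> \sum_(i <- s) f i = 0 ->
    forall i, i \in s -> f i = 0 }.

End LinearAlgebra.

(* a (a - 1) ... (a - i + 1) / i! *)
Definition gbinom (F : fieldType) (a : F) (i : nat) : F :=
  (\prod_(j < i) (a - j%:R)) / i`!%:R.

(* exp(2 pi i r / T) *)
Definition exp2ipi (R : realType) (T r : nat) : R[i] :=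
  let theta : R := 2 * pi * r%:R / T%:R in cos theta +i* sin theta.

(* [vmode A u n] is the operator u_n of Y(u,x) = \sum_n u_n x^(-n-1).
   [vmode_jacobi] is the Jacobi identity
     x0^-1 delta((x1-x2)/x0) Y(u,x1) Y(v,x2) w
       - x0^-1 delta((x2-x1)/(-x0)) Y(v,x2) Y(u,x1) w
     = x2^-1 delta((x1-x0)/x2) Y(Y(u,x0)v,x2) w
   read off at x0^(-l-1) x1^(-m-1) x2^(-n-1).  The sums over [i : nat] have
   finite support by [vmode_trunc]. *)
Record vertexAlgebra (R : realType) (V : lmodType R[i]) := VertexAlgebra {
  vmode : V -> int -> {linear V -> V};
  vacuum : V;
  vmode_linear : forall n v, linear (fun u => vmode u n v);
  vmode_trunc : forall u v, exists N : int, forall n, N <= n -> vmode u n v = 0;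
  vmode_vacuum : forall n v, vmode vacuum n v = if n == -1 then v else 0;
  vmode_creation : forall u,
    (forall n : int, 0 <= n -> vmode u n vacuum = 0) /\
    vmode u (-1) vacuum = u;
  vmode_jacobi : forall (u v w : V) (l m n : int),
    \sum_(i \in [set: nat]) ((-1) ^+ i * gbinom l%:~R i) *:
        vmode u (m + l - i%:Z) (vmode v (n + i%:Z) w)
    - \sum_(i \in [set: nat]) ((-1) ^ l * (-1) ^+ i * gbinom l%:~R i) *:
        vmode v (n + l - i%:Z) (vmode u (m + i%:Z) w)
    = \sum_(i \in [set: nat]) gbinom m%:~R i *:
        vmode (vmode u (l + i%:Z) v) (m + n - i%:Z) w }.

Section VertexAlgebras.
Variables (R : realType) (V : lmodType R[i]) (A : vertexAlgebra V).

Record va_automorphism (g : {linear V -> V}) : Prop := VAAutomorphism {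
  automorphism_bij : bijective g;
  automorphism_mode : forall v n w,
    g (vmode A v n w) = vmode A (g v) n (g w) }.

Definition has_period (g : V -> V) (T : nat) : Prop :=
  (0 < T)%N /\ forall v, iter T g v = v.

(* V^r *)
Definition eigenpart (g : V -> V) (T r : nat) : set V :=
  [set v | g v = exp2ipi R T r *: v].

Record graded_va (Vg : int -> set V) : Prop := GradedVA {
  graded_va_sum : direct_sum Vg;
  graded_va_vacuum : Vg 0 (vacuum A);
  graded_va_mode : forall (k m n : int) u v, Vg k u -> Vg n v ->
    Vg (n + k - m - 1) (vmode A u m v) }.

(* [tmode B u n] is the operator u_n of Y_W(u,x) = \sum_n u_n x^(-n-1), with
   rational [n]; [tmode_support] makes it vanish unless n is in (1/T)Z.
   [tmode_jacobi] is the twisted Jacobi identity read off at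
   x0^(-l-1) x1^(-m-1) x2^(-n-1).  On the right-hand side, the factor
   x2^-1 ((x1-x0)/x2)^(-r/T) delta((x1-x0)/x2) is the sum over k in Z of
   (x1-x0)^(k-r/T) x2^(-k+r/T-1), so only exponents m in r/T + Z occur; on the
   left-hand side the other coefficients vanish by [tmode_support]. *)
Record twistedModule (g : V -> V) (T : nat) (W : lmodType R[i]) :=
  TwistedModule {
  tmode : V -> rat -> {linear W -> W};
  tmode_linear : forall n w, linear (fun u => tmode u n w);
  tmode_support : forall (r : nat) u, (r < T)%N -> eigenpart g T r u ->
    forall (n : rat) w, n - r%:R / T%:R \isn't a Num.int -> tmode u n w = 0;
  tmode_trunc : forall (r : nat) u w, (r < T)%N -> eigenpart g T r u ->
    exists N : rat, forall n : rat,
      n - r%:R / T%:R \is a Num.int -> N <= n -> tmode u n w = 0;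
  tmode_vacuum : forall (n : rat) w,
    tmode (vacuum A) n w = if n == -1 then w else 0;
  tmode_jacobi : forall (r : nat) u v w (l : int) (m n : rat),
    (r < T)%N -> eigenpart g T r u ->
    m - r%:R / T%:R \is a Num.int -> T%:R * n \is a Num.int ->
    \sum_(i \in [set: nat]) ((-1) ^+ i * gbinom l%:~R i) *:
        tmode u (m + l%:~R - i%:R) (tmode v (n + i%:R) w)
    - \sum_(i \in [set: nat]) ((-1) ^ l * (-1) ^+ i * gbinom l%:~R i) *:
        tmode v (n + l%:~R - i%:R) (tmode u (m + i%:R) w)
    = \sum_(i \in [set: nat]) gbinom (ratr m) i *:
        tmode (vmode A u (l + i%:Z) v) (m + n - i%:R) w }.

Section TwistedModules.
Variables (g : V -> V) (T : nat) (W : lmodType R[i]).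
Variable B : twistedModule g T W.

Definition weightTN (n : rat) : Prop := exists a : nat, n = a%:R / T%:R.

(* The grading by (1/T)N is a family indexed by [rat] that vanishes outside
   (1/T)N. *)
Record graded_tmodule (Vg : int -> set V) (Wg : rat -> set W) : Prop :=
  GradedTModule {
  graded_tmodule_sum : direct_sum Wg;
  graded_tmodule_out : forall n, ~ weightTN n -> Wg n = [set 0];
  graded_tmodule_mode : forall (k : int) (m n : rat) v w,
    T%:R * m \is a Num.int -> weightTN n -> Vg k v -> Wg n w ->
    Wg (n + k%:~R - m - 1) (tmode B v m w) }.

(* A triple [(u, k, r)] stands for the operator u_(-1-k+r/T), and a sequence of
   triples for the composite of these operators. *)
Definition Eword (s : seq (V * nat * nat)) (w : W) : W :=
  foldr (fun '(u, k, r) x => tmode B u (-1 - k%:R + r%:R / T%:R) x) w s.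

Definition E_sub (n : int) : set W :=
  linspan [set x | exists (s : seq (V * nat * nat)) (w : W),
    [/\ s != [::],
        forall u k r, (u, k, r) \in s -> (r < T)%N /\ eigenpart g T r u,
        n%:~R / T%:R <= \sum_(a <- s) a.1.2%:R
                        - (\sum_(a <- s) a.2%:R) / T%:R :> rat
      & x = Eword s w]].

Definition C_sub (n : nat) : set W :=
  linspan [set x | exists (p : nat) (u : V) (w : W),
    [/\ (p < T)%N, eigenpart g T p u
      & x = tmode B u (- n%:R + p%:R / T%:R) w]].

End TwistedModules.
End VertexAlgebras.

(* Main.v *)
(** Write the degree of an operator u_(-1-k+r/T) as k - r/T.  Reordering two
    neighbouring operators in a word costs words with one operator fewer and no
    smaller total degree, and so does replacing u_(m-1) v_n by the remaining
    terms of the Jacobi identity with l = -1.  Let S be a subspace containing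
    every word that starts with an operator of degree > q, such as a weight
    truncation of W.  By induction on length, a word of total degree > q^2 lies
    in S: an operator of degree <= 0 can be moved to the right and absorbed in
    the vector, one of degree > q can be moved to the left, and otherwise all
    rounded-up degrees lie in [1, q], so two of them coincide because there are
    more than q operators; the Jacobi identity then trades this pair for
    increasingly unbalanced ones, a process bounded by the sum of squares.
    Weights in S exceed any bound as q grows, whence the zero intersections. *)

Require Import Defs.
From HB Require Import structures.
From mathcomp Require Import all_boot all_order all_algebra.
From mathcomp Require Import all_classical all_reals all_analysis.
From mathcomp Require Import complex.
From mathcomp Require Import zify ring lra.

Set Implicit Arguments.
Unset Strict Implicit.
Unset Printing Implicit Defensive.

Import Order.TTheory GRing.Theory Num.Theory.

Local Open Scope classical_set_scope.
Local Open Scope ring_scope.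

(** * Subspaces, spans and finitely supported sums *)

Section Subspaces.
Variables (K : nzRingType) (M : lmodType K) (S : set M).
Hypothesis subS : is_subspace S.

Lemma subspaceD x y : S x -> S y -> S (x + y).
Proof. by move=> Sx Sy; rewrite -[x]scale1r; apply: subS.2. Qed.

Lemma subspaceZ a x : S x -> S (a *: x).
Proof. by move=> Sx; rewrite -[_ *: _]addr0; apply: subS.2 => //; case: subS. Qed.

Lemma subspaceB x y : S x -> S y -> S (x - y).
Proof. by move=> Sx Sy; rewrite -scaleN1r addrC; apply: subS.2. Qed.

Lemma subspace_sum (I : Type) (s : seq I) (P : pred I) (F : I -> M) :
  (forall i, P i -> S (F i)) -> S (\sum_(i <- s | P i) F i).
Proof.
by move=> SF; elim/big_ind: _ => //; [case: subS | exact: subspaceD].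
Qed.

Lemma subspace_sum_seq (I : eqType) (s : seq I) (F : I -> M) :
  (forall i, i \in s -> S (F i)) -> S (\sum_(i <- s) F i).
Proof. by move=> SF; rewrite big_seq; apply: subspace_sum. Qed.

Lemma linspan_sub (X : set M) : X `<=` S -> linspan X `<=` S.
Proof.
move=> XS x [s [sX ->]]; apply: subspace_sum_seq => p ps.
by apply/subspaceZ/XS/sX.
Qed.

End Subspaces.

Lemma linspan0 (K : nzRingType) (M : lmodType K) (X : set M) : linspan X 0.
Proof. by exists [::]; rewrite big_nil. Qed.

Lemma fsum_eventually0 (M : zmodType) (N : nat) (F : nat -> M) :
  (forall i, (N <= i)%N -> F i = 0) ->
  \sum_(i \in [set: nat]) F i = \sum_(i < N) F i.
Proof.
move=> F0; rewrite fsbig_ord; apply: esym; apply: fsbig_widen => //.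
by move=> i [_ /= /negP]; rewrite -leqNgt => /F0.
Qed.

(** * Sums of homogeneous subspaces *)

Section Coproducts.
Variables (K : nzRingType) (M : lmodType K) (I : choiceType).
Variables (X : I -> set M).

Lemma coprod_incl (D : set I) i x : D i -> X i x -> coprod D X x.
Proof.
move=> Di Xx; exists [:: i], (fun=> x); split=> [//|j|]; last by rewrite big_seq1.
by rewrite inE => /eqP ->.
Qed.

Hypothesis subX : forall i, is_subspace (X i).

Lemma coprod_subspace (D : set I) : is_subspace (coprod D X).
Proof.
split; first by exists [::], (fun=> 0); split=> //; rewrite big_nil.
move=> a _ _ [s [f [us sf ->]]] [s' [f' [us' sf' ->]]].
(* The two supports may overlap, so components are extended by 0 and added over the merged
   support. *)
pose h i := a *: (if i \in s then f i else 0) + (if i \in s' then f' i else 0).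
exists (undup (s ++ s')), h; split; first exact: undup_uniq.
  move=> i; rewrite mem_undup mem_cat => iss'; split.
    by case/orP: iss' => [/sf[]|/sf'[]].
  have X0 : X i 0 by case: (subX i).
  by apply: (subX i).2; [case: ifP => // /sf[] | case: ifP => // /sf'[]].
rewrite big_split /= -scaler_sumr.
suff sumE (u v : seq I) (k : I -> M) : uniq u -> {subset u <= v} ->
    \sum_(i <- u) k i = \sum_(i <- undup v) (if i \in u then k i else 0).
  congr (a *: _ + _); apply: sumE => // i ii; rewrite mem_cat ii ?orbT //.
move=> uu uv; rewrite -big_mkcond -big_filter; apply: perm_big.
rewrite uniq_perm ?filter_uniq ?undup_uniq // => i; rewrite mem_filter mem_undup.
by case: (boolP (i \in u)) => // /uv ->.
Qed.

(** Subtracting the two decompositions of [x] gives a vanishing sum over disjoint supports, and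
    independence kills each component. *)
Lemma disjoint_coprod0 (D E : set I) x :
  direct_sum X -> (forall i, D i -> E i -> False) ->
  coprod D X x -> coprod E X x -> x = 0.
Proof.
move=> dsX DE [s [f [us sf xE]]] [s' [f' [us' sf' xE']]].
have ss' i : i \in s -> i \in s' -> False.
  by move=> /sf[Di _] /sf'[Ei _]; apply: (DE i).
pose h i := if i \in s then f i else - f' i.
have hE : \sum_(i <- s ++ s') h i = 0.
  rewrite big_cat /=; apply/eqP; rewrite addr_eq0 -sumrN; apply/eqP.
  transitivity x.
    by rewrite xE; apply: eq_big_seq => i si; rewrite /h si.
  rewrite xE'; apply: eq_big_seq => i si; rewrite /h.
  by case: (boolP (i \in s)) => [/ss'/(_ si)//|_]; rewrite opprK.
have h0 := direct_sum_indep dsX _ _ hE.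
rewrite xE big_seq big1 // => i si.
have <- : h i = f i by rewrite /h si.
apply: h0.
- rewrite cat_uniq us us' andbT /=; apply/hasPn => j sj'.
  by apply/negP => sj; apply: (ss' j).
- move=> j; rewrite mem_cat /h; case: ifP => [/sf[] //|_ /= /sf'[_ Xj]].
  by rewrite -scaleN1r -[_ *: _]addr0; apply: (subX j).2 => //; case: (subX j).
- by rewrite mem_cat si.
Qed.

End Coproducts.

(** * Permutations of lists and roots of unity *)

(** Adjacent swaps bring one entry in front of a block, hence one block in front of another, and
    block exchanges generate all permutations. *)
Lemma adjacent_perm_ind (E : eqType) (Q : seq E -> Prop) :
  (forall L1 a b L2, Q (L1 ++ a :: b :: L2) -> Q (L1 ++ b :: a :: L2)) ->
  forall L L', perm_eq L L' -> Q L -> Q L'.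
Proof.
move=> swapQ.
have frontQ L1 : forall P a L2, Q (P ++ L1 ++ a :: L2) -> Q (P ++ a :: L1 ++ L2).
  elim: L1 => [//|b L1 IH] P a L2 /=.
  by rewrite -cat_rcons => /IH; rewrite cat_rcons => /swapQ.
apply: catCA_perm_ind => s1 s2 s3.
suff: forall P, Q (P ++ s1 ++ s2 ++ s3) -> Q (P ++ s2 ++ s1 ++ s3).
  by move/(_ [::]).
elim: s2 => [//|a s2 IH] P /= /frontQ.
by rewrite -cat_rcons => /IH; rewrite cat_rcons.
Qed.

Lemma perm_not_uniq_map (E F : eqType) (f : E -> F) (L : seq E) :
  ~~ uniq (map f L) -> exists a b L', perm_eq L (a :: b :: L') /\ f a = f b.
Proof.
elim: L => [//|x L IH] /=; rewrite negb_and negbK => /orP[/mapP[y yL fxy]|/IH].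
  by exists x, y, (rem y L); rewrite perm_cons perm_to_rem.
move=> [a [b [L' [LL' fab]]]]; exists a, b, (x :: L'); split=> //.
apply: perm_trans (_ : perm_eq _ (x :: [:: a; b] ++ L')) _.
  by rewrite perm_cons.
by rewrite -cat1s perm_catCA.
Qed.

Lemma exp2ipiD (R : realType) (T r r' : nat) :
  exp2ipi R T (r + r') = exp2ipi R T r * exp2ipi R T r'.
Proof.
rewrite /exp2ipi natrD mulrDr mulrDl cosD sinD.
by apply/eqP; rewrite eq_complex /= eqxx addrC eqxx.
Qed.

Lemma exp2ipi_period (R : realType) (T k : nat) : (0 < T)%N ->
  exp2ipi R T (k * T) = 1.
Proof.
move=> T0; elim: k => [|k IH].
  by rewrite /exp2ipi mul0n mulr0 mul0r cos0 sin0.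
rewrite mulSn exp2ipiD IH mulr1 /exp2ipi.
rewrite -mulrA divff ?pnatr_eq0 ?lt0n_neq0 // mulr1 mulr_natl cos2pi sin2pi //.
Qed.

Lemma exp2ipi_mod (R : realType) (T r : nat) : (0 < T)%N ->
  exp2ipi R T (r %% T) = exp2ipi R T r.
Proof.
by move=> T0; rewrite {2}(divn_eq r T) exp2ipiD exp2ipi_period // mul1r.
Qed.

Lemma sum_le_size (K : numDomainType) (E : eqType) (L : seq E) (F : E -> K) c :
  (forall a, a \in L -> F a <= c) -> \sum_(a <- L) F a <= c *+ size L.
Proof.
elim: L => [|a L IH] FL; first by rewrite big_nil.
rewrite big_cons mulrS lerD ?FL ?mem_head //.
by apply: IH => b bL; apply: FL; rewrite inE bL orbT.
Qed.

(** [vmode] and [tmode] are linear in the algebra element only propositionally; a bundled copy gives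
    access to [linearZ], [linear0] and [linear_sum]. *)
Lemma linear_bundled (K : nzRingType) (M N : lmodType K) (f : M -> N) :
  linear f -> exists h : {linear M -> N}, h =1 f.
Proof.
move=> lf; pose f_lin := GRing.isLinear.Build K M N *:%R f lf.
pose h : {linear M -> N} := HB.pack f f_lin.
by exists h.
Qed.

(** * Words in the twisted operators *)

Section Words.
Variables (R : realType) (V : lmodType R[i]) (A : vertexAlgebra V).
Variables (g : {linear V -> V}) (T : nat).
Hypotheses (hg : va_automorphism A g) (T_gt0 : (0 < T)%N).
Variables (W : lmodType R[i]) (B : twistedModule A g T W).

(* A letter [(u, n)] stands for the operator u_n; this includes operators
   u_(-1-k+r/T) with k < 0. *)
Definition letter (a : V * rat) : Prop := exists r : nat,
  [/\ (r < T)%N, eigenpart g T r a.1 & a.2 - r%:R / T%:R \is a Num.int].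

(* k - r/T for the operator u_(-1-k+r/T), so that k = ceil (depth a) *)
Definition depth (a : V * rat) : rat := - 1 - a.2.

Definition word (L : seq (V * rat)) (w : W) : W :=
  foldr (fun a x => tmode B a.1 a.2 x) w L.

Definition total_depth (L : seq (V * rat)) : rat := \sum_(a <- L) depth a.

Lemma word_linear L : linear (word L).
Proof. by elim: L => [//|a L IH] c x y /=; rewrite IH linearP. Qed.

HB.instance Definition _ L :=
  GRing.isLinear.Build R[i] W W *:%R (word L) (word_linear L).

Lemma word_cat L1 L2 w : word (L1 ++ L2) w = word L1 (word L2 w).
Proof. by rewrite /word foldr_cat. Qed.

Lemma eigenpart_vmode r r' u v (i : int) :
  eigenpart g T r u -> eigenpart g T r' v ->
  eigenpart g T ((r + r') %% T) (vmode A u i v).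
Proof.
rewrite /eigenpart /= => gu gv.
have [h hE] := linear_bundled (vmode_linear A i v).
rewrite (automorphism_mode hg) gu gv exp2ipi_mod // exp2ipiD linearZ /=.
by rewrite -!hE linearZ /= scalerA mulrC.
Qed.

Lemma letter_shift u n x : letter (u, n) -> x \is a Num.int -> letter (u, n + x).
Proof.
move=> [r [/= rT ur nr]] xZ; exists r; split=> //=.
by rewrite addrAC rpredD.
Qed.

(** Reducing [r + r'] modulo [T] changes (r + r')/T by an integer, so the exponent stays in the
    coset required by the new eigenspace. *)
Lemma letter_vmode u v n n' (i : int) x : letter (u, n) -> letter (v, n') ->
  x \is a Num.int -> letter (vmode A u i v, n + n' + x).
Proof.
move=> [r [/= rT ur nr]] [r' [/= rT' vr nr']] xZ.
exists ((r + r') %% T)%N; split=> /=; first exact: ltn_pmod.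
  exact: eigenpart_vmode.
have Tn0 : T%:R != 0 :> rat by rewrite pnatr_eq0 lt0n_neq0.
have -> : n + n' + x - ((r + r') %% T)%:R / T%:R =
    (n - r%:R / T%:R) + (n' - r'%:R / T%:R) + x + ((r + r') %/ T)%:R.
  have := congr1 (fun k : nat => k%:R / T%:R : rat) (divn_eq (r + r') T).
  rewrite /= !natrD natrM !mulrDl mulfK // => /eqP; rewrite -subr_eq => /eqP <-.
  by ring.
by apply: rpredD (natr_int _ _); apply: rpredD xZ; apply: rpredD.
Qed.

Lemma letter_scale a : letter a -> T%:R * a.2 \is a Num.int.
Proof.
move=> [r [_ _ h]]; rewrite -[a.2](subrK (r%:R / T%:R)) mulrDr.
apply: rpredD; first by rewrite rpredM ?natr_int.
by rewrite mulrC divfK ?natr_int // pnatr_eq0 lt0n_neq0.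
Qed.

Lemma tmode_eventually0 u n x : letter (u, n) ->
  exists N : nat, forall i, (N <= i)%N -> tmode B u (n + i%:R) x = 0.
Proof.
move=> [r [/= rT ur nr]]; have [N hN] := tmode_trunc B x rT ur.
exists (Num.bound `|N - n|) => i iN; apply: hN.
  by rewrite addrAC; apply: rpredD => //; rewrite natr_int.
rewrite -lerBlDl (le_trans (ler_norm _)) // ltW //.
by rewrite (lt_le_trans (archi_boundP _)) // ler_nat.
Qed.

(** This is the twisted Jacobi identity at l = 0, where the binomials (0 choose i) with i > 0 vanish
    and each sum on the left keeps only its first term. *)
Lemma tmode_commutator u v n n' x : letter (u, n) -> letter (v, n') ->
  tmode B u n (tmode B v n' x) - tmode B v n' (tmode B u n x) =
  \sum_(i \in [set: nat]) gbinom (ratr n : R[i]) i *: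
    tmode B (vmode A u i%:Z v) (n + n' - i%:R) x.
Proof.
move=> lu lv; have lu' := lu; case: lu' => r [/= rT ur nr].
have gbinom0 i : gbinom (0%:~R : R[i]) i.+1 = 0.
  by rewrite /gbinom big_ord_recl /= subrr !mul0r.
have := tmode_jacobi B v x 0 rT ur nr (letter_scale lv).
rewrite [X in X - _ = _](@fsum_eventually0 _ 1); last first.
  by case=> // i _; rewrite gbinom0 mulr0 scale0r.
rewrite [X in _ - X = _](@fsum_eventually0 _ 1); last first.
  by case=> // i _; rewrite gbinom0 mulr0 scale0r.
rewrite !big_ord1 {1 2}/gbinom !big_ord0 fact0 invr1 !mulr1 !scale1r /=.
rewrite !(addr0, subr0, mulr0n).
by move=> ->; under eq_fsbigr do rewrite add0r.
Qed.

(** * Reduction of words of large total depth *)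

Section Reduction.
Variables (S : set W) (q : nat).
Hypothesis subS : is_subspace S.
Hypothesis deepS : forall u n w,
  letter (u, n) -> q%:R < depth (u, n) -> S (tmode B u n w).

Definition admissible (s : nat) (L : seq (V * rat)) : Prop :=
  [/\ size L = s, forall a, a \in L -> letter a & (q ^ 2)%:R < total_depth L].

Definition reducible (s : nat) : Prop :=
  forall L w, admissible s L -> S (word L w).

Lemma admissible_perm s L L' :
  perm_eq L L' -> admissible s L -> admissible s L'.
Proof.
move=> LL' [sL vL dL]; split; first by rewrite -(perm_size LL').
  by move=> a; rewrite -(perm_mem LL'); apply: vL.
by rewrite /total_depth -(perm_big _ LL').
Qed.

(** The commutator merges the two letters into letters whose depth exceeds the sum of the two depths
    by i + 1, so the shorter words stay admissible. *)
Lemma word_swap s : reducible s -> forall L1 a b L2 w,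
  admissible s.+1 (L1 ++ a :: b :: L2) ->
  S (word (L1 ++ a :: b :: L2) w) -> S (word (L1 ++ b :: a :: L2) w).
Proof.
move=> red L1 [u n] [v n'] L2 w [sL vL dL] SL.
have lu : letter (u, n) by apply: vL; rewrite mem_cat !inE eqxx !orbT.
have lv : letter (v, n') by apply: vL; rewrite mem_cat !inE eqxx !orbT.
rewrite -[word _ _](subKr (word (L1 ++ (u, n) :: (v, n') :: L2) w)).
apply: subspaceB => //; rewrite !word_cat -linearB /= tmode_commutator //.
rewrite linear_sum; apply: subspace_sum => // i _.
rewrite linearZ /=; apply: subspaceZ => //.
rewrite -[X in word _ X]/(word ((_, _) :: L2) w) -word_cat; apply: red; split.
- by move: sL; rewrite !size_cat /= !addnS => -[].
- move=> a; rewrite mem_cat inE => /or3P[aL|/eqP ->|aL].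
  + by apply: vL; rewrite mem_cat aL.
  + by apply: letter_vmode => //; rewrite rpredN natr_int.
  + by apply: vL; rewrite mem_cat !inE aL !orbT.
- apply: lt_le_trans dL _; rewrite /total_depth !big_cat !big_cons /depth /=.
  have : 0 <= i%:R :> rat by [].
  lra.
Qed.

Lemma word_perm s : reducible s -> forall L L' w,
  perm_eq L L' -> admissible s.+1 L -> S (word L w) -> S (word L' w).
Proof.
move=> red L L' w LL' aL SL.
pose Q L := admissible s.+1 L /\ S (word L w).
suff [] : Q L' by [].
apply: adjacent_perm_ind LL' (conj aL SL) => L1 a b L2 [aL12 SL12].
split; last exact: word_swap red _ _ _ _ _ aL12 SL12.
by apply: admissible_perm aL12; rewrite perm_cat2l (perm_catCA [:: a] [:: b]).
Qed.

(* With l = -1 the twisted Jacobi identity says that the products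
   u_(n-i) v_(n'+i), over all i in Z and reordered for i < 0, sum up to a
   combination of single letters; each term other than [word (a :: b :: L) w]
   is then more unbalanced in depth. *)
Lemma word_balance s u v n n' L w : reducible s ->
  admissible s.+1 ((u, n) :: (v, n') :: L) ->
  (forall i : nat,
     S (word ((u, n - i.+1%:R) :: (v, n' + i.+1%:R) :: L) w)) ->
  (forall i : nat,
     S (word ((v, n' - i.+1%:R) :: (u, n + i.+1%:R) :: L) w)) ->
  S (word ((u, n) :: (v, n') :: L) w).
Proof.
move=> red [sL vL dL] SL1 SL2; set x := word L w.
have lu : letter (u, n) by apply: vL; rewrite !inE eqxx.
have lv : letter (v, n') by apply: vL; rewrite !inE eqxx !orbT.
have [r [/= rT ur nr]] := lu.
(* With l = -1, the exponent m = n + 1 makes the i = 0 term of the first sum exactly u_n v_n'. *)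
have nr1 : n + 1 - r%:R / T%:R \is a Num.int by rewrite addrAC rpredD.
have := tmode_jacobi B v x (-1) rT ur nr1 (letter_scale lv).
have shift1 i : n + 1 + (-1)%:~R - i%:R = n - i%:R by rewrite addrK.
have [N vN] := tmode_eventually0 x lv.
(* The bound [N.+1] rather than [N] guarantees that there is an i = 0 term to split off. *)
rewrite (@fsum_eventually0 _ N.+1); last first.
  by move=> i Ni; rewrite vN ?linear0 ?scaler0 // ltnW.
rewrite big_ord_recl /gbinom big_ord0 fact0 invr1 !mulr1 scale1r shift1 /=.
rewrite !mulr0n addr0 subr0 => /(canRL (subrK _)) /(canRL (addrK _)).
rewrite /= -/x => ->; apply: subspaceB => //; first apply: subspaceD => //.
- apply: subspace_sum => // i _; apply: subspaceZ => //.
  rewrite -[X in S X]/(word ((_, _) :: L) w); apply: red; split.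
  + by case: sL => <-.
  + move=> a; rewrite inE => /orP[/eqP ->|aL]; last first.
      by apply: vL; rewrite !inE aL !orbT.
    have -> : n + 1 + n' - i%:R = n + n' + (1 - i%:R) by ring.
    by apply: letter_vmode => //; apply: rpredB; rewrite ?natr_int.
  (* The merged letter has depth equal to the sum of the two depths plus i. *)
  + apply: lt_le_trans dL _; rewrite /total_depth !big_cons /depth /=.
    have : 0 <= i%:R :> rat by [].
    lra.
- apply: subspace_sum => // i _; apply: subspaceZ => //.
  have -> : n' + (-1)%:~R - i%:R = n' - i.+1%:R by rewrite -natr1; ring.
  have -> : n + 1 + i%:R = n + i.+1%:R by rewrite -natr1; ring.
  exact: SL2.
- apply: subspace_sum => // i _; apply: subspaceZ => //.
  by rewrite shift1; apply: SL1.
Qed.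


(** Rounding up the depths makes this sum of squares an integer, so a strict increase is at least 1
    and induction on the remaining gap terminates. *)
Definition unbalance (L : seq (V * rat)) : int :=
  \sum_(a <- L) (Num.ceil (depth a)) ^+ 2.

Lemma ceil_depthD u n (i : nat) :
  Num.ceil (depth (u, n + i%:R)) = Num.ceil (depth (u, n)) - i%:Z.
Proof.
rewrite /depth /= opprD addrA ceilDrz ?rpredN ?natr_int //.
by rewrite pmulrn -rmorphN /= intrKceil.
Qed.

Lemma ceil_depthB u n (i : nat) :
  Num.ceil (depth (u, n - i%:R)) = Num.ceil (depth (u, n)) + i%:Z.
Proof. by rewrite -[in RHS](subrK i%:R n) ceil_depthD subrK. Qed.

Lemma word_shallow s L w a : reducible s -> admissible s.+1 L ->
  a \in L -> depth a <= 0 -> S (word L w).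
Proof.
move=> red aL a_in da.
have LL' : perm_eq (rem a L ++ [:: a]) L.
  by rewrite perm_catC perm_sym; apply: perm_to_rem.
have [sL' vL' dL'] : admissible s.+1 (rem a L ++ [:: a]).
  by apply: admissible_perm aL; rewrite perm_sym.
apply: (word_perm red LL') => //; rewrite word_cat; apply: red; split.
- by move: sL'; rewrite size_cat addn1 => -[].
- by move=> b bL; apply: vL'; rewrite mem_cat bL.
- move: dL'; rewrite /total_depth big_cat big_seq1 /= => /lt_le_trans; apply.
  by rewrite gerDl.
Qed.

Lemma word_deep s L w a : reducible s -> admissible s.+1 L ->
  a \in L -> q%:R < depth a -> S (word L w).
Proof.
move=> red aL a_in da; have LL' := perm_to_rem a_in.
apply: (word_perm red (L := a :: rem a L)); first by rewrite perm_sym.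
  exact: admissible_perm aL.
case: aL => _ vL _; move: (vL _ a_in) da => {LL' a_in}; case: a => u n la da.
exact: deepS.
Qed.

Lemma word_moderate s L w : reducible s -> admissible s.+1 L ->
  ((forall a, a \in L -> 1 <= Num.ceil (depth a) <= q%:Z) -> S (word L w)) ->
  S (word L w).
Proof.
move=> red aL SL.
have [/hasP[a a_in da]|/hasPn posL] := boolP (has (fun a => depth a <= 0) L).
  exact: (word_shallow _ red aL a_in da).
have [/hasP[a a_in da]|/hasPn smallL] := boolP (has (fun a => q%:R < depth a) L).
  exact: (word_deep _ red aL a_in da).
apply: SL => a a_in; have := posL _ a_in; have := smallL _ a_in.
rewrite -leNgt -ltNge -ceil_gt0 ceil_le_int => dq d0; exact/andP.
Qed.

(** If the rounded depths were distinct in [1, q], there would be at most q letters, each of depth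
    at most q, and the total could not exceed q^2. *)
Lemma moderate_pair s L : admissible s L ->
  (forall a, a \in L -> 1 <= Num.ceil (depth a) <= q%:Z) ->
  exists a b L',
    perm_eq L (a :: b :: L') /\ Num.ceil (depth a) = Num.ceil (depth b).
Proof.
move=> [_ _ dL] ceilL; apply: perm_not_uniq_map; apply/negP => uL.
have : (size L <= q)%N.
  rewrite -(size_map (fun a => Num.ceil (depth a))) -(size_iota 1 q).
  rewrite -(size_map Posz); apply: uniq_leq_size => // _ /mapP[a a_in ->].
  have := ceilL _ a_in; case: (Num.ceil _) => // k kq.
  by apply/map_f; rewrite mem_iota; lia.
apply/negP; rewrite -ltnNge.
suff : (q ^ 2)%:R < (q * size L)%:R :> rat.
  by rewrite ltr_nat -mulnn ltn_mul2l => /andP[].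
apply: lt_le_trans dL _; rewrite natrM mulr_natr.
by apply: sum_le_size => a /ceilL /andP[_]; rewrite ceil_le_int.
Qed.

Lemma word_reduction s : reducible s -> reducible s.+1.
Proof.
move=> red.
(* A word of s + 1 letters with rounded depths in [1, q] has unbalance at most q^2 (s + 1); [j]
   bounds how far the unbalance is from exceeding that value. *)
suff claim (j : nat) : forall L w, admissible s.+1 L ->
    (q ^ 2 * s.+1)%N%:Z < unbalance L + j%:Z -> S (word L w).
  move=> L w aL; apply: (claim (q ^ 2 * s.+1).+1) => //.
  have : 0 <= unbalance L by apply: sumr_ge0 => a _; apply: sqr_ge0.
  lia.
(* For j = 0 the assumed unbalance already exceeds the maximum for moderate words, a
   contradiction. *)
elim: j => [|j IH] L w aL measL; apply: (word_moderate red aL) => ceilL.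
  have [sL _ _] := aL.
  have : unbalance L <= (q ^ 2)%N%:Z *+ size L.
    apply: sum_le_size => a /ceilL /andP[d1 dq].
    rewrite -natz natrX natz lerXn2r ?nnegrE //; lia.
  by rewrite sL -mulr_natr natz -PoszM; lia.
have [[u n] [[v n'] [L' [LL' ceilE]]]] := moderate_pair aL ceilL.
have LL'' : perm_eq ((u, n) :: (v, n') :: L') L by rewrite perm_sym.
have aL' := admissible_perm LL' aL.
have [sL' vL' dL'] := aL'.
have lu : letter (u, n) by apply: vL'; rewrite !inE eqxx.
have lv : letter (v, n') by apply: vL'; rewrite !inE eqxx !orbT.
(* Replacing equal rounded depths c, c by c + (i + 1), c - (i + 1) raises the sum of squares by 2 (i
   + 1)^2 > 0, so [IH] applies. *)
have bal (i : nat) (a b : V * rat) :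
    Num.ceil (depth a) = Num.ceil (depth (u, n)) + i.+1%:Z ->
    Num.ceil (depth b) = Num.ceil (depth (u, n)) - i.+1%:Z ->
    letter a -> letter b ->
    depth a + depth b = depth (u, n) + depth (v, n') ->
    S (word (a :: b :: L') w).
  move=> ca cb la lb dab; apply: IH; first split.
  - by rewrite -sL'.
  - move=> c; rewrite !inE => /or3P[/eqP ->|/eqP ->|cL] //.
    by apply: vL'; rewrite !inE cL !orbT.
  - move: dL'; rewrite /total_depth !big_cons [X in _ < X -> _]addrA -dab.
    by rewrite -addrA.
  - apply: lt_le_trans measL _.
    rewrite /unbalance (perm_big _ LL') /= !big_cons ca cb -ceilE.
    set c := Num.ceil _; set X := \sum_(_ <- _) _.
    have -> : (c + i.+1%:Z) ^+ 2 + ((c - i.+1%:Z) ^+ 2 + X) =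
        c ^+ 2 + (c ^+ 2 + X) + (i.+1 * i.+1).*2%:Z.
      by rewrite -muln2 !PoszM; ring.
    have : (0 < i.+1 * i.+1)%N by [].
    lia.
apply: (word_perm red LL'' aL'); apply: (word_balance red aL') => i;
  apply: (bal i).
all: try by rewrite (ceil_depthB, ceil_depthD) -?ceilE.
all: try by apply: letter_shift; rewrite ?rpredN ?natr_int.
all: by rewrite /depth /=; ring.
Qed.

Lemma all_reducible s : reducible s.
Proof.
elim: s => [|s /word_reduction //] [|a L] w [] // _ _.
by rewrite /total_depth big_nil ltNge ler0n.
Qed.

End Reduction.
End Words.

(** * Weight estimates in the graded module *)

Section GradedModule.
Variables (R : realType) (V : lmodType R[i]) (A : vertexAlgebra V).
Variables (Vg : int -> set V) (t : int).
Hypotheses (hV : graded_va A Vg) (ht : forall n : int, n < t -> Vg n = [set 0]).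
Variables (g : {linear V -> V}) (T : nat).
Hypotheses (hg : va_automorphism A g) (T_gt0 : (0 < T)%N).
Variables (W : lmodType R[i]) (B : twistedModule A g T W).
Variables (Wg : rat -> set W) (hW : graded_tmodule B Vg Wg).

Let weight_ge (n : nat) : set W :=
  coprod [set k : rat | n%:R + t%:~R - (2 * T%:R - 1) / T%:R <= k] Wg.

Let subWg := direct_sum_subspace (graded_tmodule_sum hW).

Lemma weight_ge_subspace n : is_subspace (weight_ge n).
Proof. exact: coprod_subspace. Qed.

(** Depths lie in (1/T)Z, so a strict inequality gains 1/T; this gain is the 1/T in -(2T-1)/T = -2 +
    1/T. *)
Lemma scaled_int_gt (x : rat) (q : nat) :
  T%:R * x \is a Num.int -> q%:R < x -> q%:R + T%:R^-1 <= x.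
Proof.
have T0 : 0 < T%:R :> rat by rewrite ltr0n.
move=> /intrP[z zE] qx.
rewrite -(ler_pM2l T0) mulrDr mulfV ?gt_eqF // zE.
have : (T * q)%:R < z%:~R :> rat by rewrite -zE natrM ltr_pM2l.
by rewrite -natrM pmulrn ltr_int natr1 pmulrn ler_int; lia.
Qed.

(** On homogeneous components of weights k >= t and j >= 0, the image has weight j + k + depth >= t
    + q + 1/T, which is the bound for n = q + 2. *)
Lemma letter_weight_ge q u m w : letter g T (u, m) -> q%:R < depth (u, m) ->
  weight_ge q.+2 (tmode B u m w).
Proof.
move=> lu qu.
have subS := weight_ge_subspace q.+2.
have TmZ := letter_scale T_gt0 lu.
have T0 : T%:R != 0 :> rat by rewrite pnatr_eq0 lt0n_neq0.
have qm : q%:R + T%:R^-1 <= - 1 - m.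
  by apply: scaled_int_gt => //; rewrite mulrBr rpredB // mulrN1 rpredN natr_int.
have [su [fu [_ hfu ->]]] : coprod setT Vg u.
  by rewrite (direct_sum_span (graded_va_sum hV)).
have [sw [fw [_ hfw ->]]] : coprod setT Wg w.
  by rewrite (direct_sum_span (graded_tmodule_sum hW)).
rewrite linear_sum; apply: subspace_sum_seq => // j /hfw[_ fj].
have [h hE] := linear_bundled (tmode_linear B m (fw j)).
rewrite -hE linear_sum; apply: subspace_sum_seq => // k /hfu[_ fk]; rewrite hE.
have [k_lt|k_ge] := ltP k t.
  by move: fk; rewrite ht // => ->; rewrite -hE linear0; case: subS.
have [j_wt|j_out] := pselect (weightTN T j); last first.
  move: fj; rewrite (graded_tmodule_out hW) // => ->.
  by rewrite linear0; case: subS.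
apply: coprod_incl (graded_tmodule_mode hW _ _ fk fj) => //=.
have j0 : 0 <= j by case: j_wt => a ->; rewrite divr_ge0.
have kt : t%:~R <= k%:~R :> rat by rewrite ler_int.
rewrite mulrBl mulfK // mul1r -2!natr1.
lra.
Qed.

Lemma C_sub_weight_ge n : (2 <= n)%N -> C_sub B n `<=` weight_ge n.
Proof.
case: n => [|[|q]] // _; apply: linspan_sub; first exact: weight_ge_subspace.
move=> _ [p [u [w [pT up ->]]]].
have T0 : 0 < T%:R :> rat by rewrite ltr0n.
apply: letter_weight_ge.
  by exists p; split=> //=; rewrite addrK rpredN natr_int.
(* For n = q + 2 the operator has depth q + 1 - p/T, which exceeds q because p < T. *)
have : p%:R / T%:R < 1 :> rat by rewrite ltr_pdivrMr // mul1r ltr_nat.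
by rewrite /depth /= -2!natr1; lra.
Qed.

Lemma E_sub_weight_ge q (m : int) : (q ^ 2)%:R < m%:~R / T%:R :> rat ->
  E_sub B m `<=` weight_ge q.+2.
Proof.
move=> qm; apply: linspan_sub; first exact: weight_ge_subspace.
move=> _ [s [w [_ sv sm ->]]].
pose to_letter (a : V * nat * nat) : V * rat :=
  (a.1.1, - 1 - a.1.2%:R + a.2%:R / T%:R).
have -> : Eword B s w = word B (map to_letter s) w.
  by elim: s {sv sm} => [//|[[u k] r] s IH] /=; rewrite IH.
apply: (@all_reducible _ _ _ _ _ hg T_gt0 _ _ _ q (weight_ge_subspace q.+2)
  _ (size s)).
  by move=> u n x; apply: letter_weight_ge.
split; first by rewrite size_map.
  move=> _ /mapP[[[u k] r] /sv[rT ur] ->]; exists r; split=> //=.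
  by rewrite addrK rpredB ?natr_int.
apply: lt_le_trans qm (le_trans sm _).
rewrite /total_depth big_map mulr_suml -sumrB le_eqVlt; apply/orP; left.
by apply/eqP; apply: eq_bigr => a _; rewrite /depth /=; ring.
Qed.

(** A vector has finitely many components, so its weights are bounded above by some b, while for
    large n the truncation only allows weights above b. *)
Lemma weight_ge_cap0 w : (forall n, (2 <= n)%N -> weight_ge n w) -> w = 0.
Proof.
move=> hw.
have [s [f [us sf wE]]] : coprod setT Wg w.
  by rewrite (direct_sum_span (graded_tmodule_sum hW)).
pose b := \sum_(i <- s) `|i|.
have sb i : i \in s -> i <= b.
  move=> si; apply: le_trans (ler_norm i) _.
  by rewrite /b (big_rem _ si) /= lerDl sumr_ge0.
(* Since (2T-1)/T < 2, any n >= b - t + 2 pushes the truncation above b; the two extra successors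
   give n >= 2. *)
pose n := (Num.bound `|b - t%:~R + 2|).+2.
apply: (disjoint_coprod0 subWg (D := [set i | i <= b])
  (E := [set k | n%:R + t%:~R - (2 * T%:R - 1) / T%:R <= k])).
- exact: graded_tmodule_sum hW.
- move=> i /= ib ni.
  have := archi_boundP (normr_ge0 (b - t%:~R + 2)).
  have := ler_norm (b - t%:~R + 2).
  have T0 : 0 < T%:R :> rat by rewrite ltr0n.
  have : 0 < T%:R^-1 :> rat by rewrite invr_gt0.
  move: ni; rewrite mulrBl mulfK ?gt_eqF // mul1r /n -2!natr1.
  lra.
- by exists s, f; split=> // i si; split; [apply: sb | case: (sf i si)].
- exact: hw.
Qed.

End GradedModule.

(** * Numerical threshold and conclusion *)

(** For q > 0 the estimate q < 2^q gives q^2 T < q T (T + 1) 2^q T; for q = 0 the threshold is 0 and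
    the strictness comes from 0 < m. *)
Lemma degree_bound (T q : nat) (m : int) : (0 < T)%N ->
  (q * T * (T + 1) * 2 ^ q * T)%N%:Z <= m -> 0 < m ->
  (q ^ 2)%:R < m%:~R / T%:R :> rat.
Proof.
move=> T_gt0 qm m0; rewrite ltr_pdivlMr ?ltr0n // -natrM pmulrn ltr_int.
case: q qm => [|q] qm; first by rewrite mul0n.
apply: lt_le_trans qm; rewrite ltz_nat -mulnn ltn_pmul2r // -!mulnA.
rewrite ltn_pmul2l // mulnA; apply: leq_trans (ltn_expl q.+1 (ltnSn 1)) _.
by rewrite leq_pmull // muln_gt0 T_gt0 addn1.
Qed.

Theorem proposition6p5
  (R : realType) (V : lmodType R[i]) (A : vertexAlgebra V)
  (Vg : int -> set V) (t : int)
  (hV : graded_va A Vg)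
  (ht : forall n : int, n < t -> Vg n = [set 0])
  (g : {linear V -> V}) (T : nat)
  (hg : va_automorphism A g) (hT : has_period g T)
  (W : lmodType R[i]) (B : twistedModule A g T W)
  (Wg : rat -> set W) (hW : graded_tmodule B Vg Wg) :
  let Wge (n : nat) : set W :=
    coprod [set k : rat |
      n%:R + t%:~R - (2 * T%:R - 1) / T%:R <= k] Wg in
  [/\ forall n : nat, (2 <= n)%N -> C_sub B n `<=` Wge n,
      \bigcap_(n in [set n : int | 0 <= n]) E_sub B n =
        \bigcap_(n in [set n : nat | (2 <= n)%N]) C_sub B n,
      \bigcap_(n in [set n : nat | (2 <= n)%N]) C_sub B n = [set 0]
    & forall (n : nat) (m : int), (2 <= n)%N ->
        ((n - 2) * T * (T + 1) * 2 ^ (n - 2) * T)%N%:Z <= m -> 0 < m ->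
        E_sub B m `<=` Wge n].
Proof.
move=> Wge; have T_gt0 : (0 < T)%N by case: hT.
have capC : \bigcap_(n in [set n : nat | (2 <= n)%N]) C_sub B n = [set 0].
  apply/seteqP; split=> [w hw /=|_ -> n _]; last exact: linspan0.
  apply: (weight_ge_cap0 T_gt0 hW) => n n2.
  by apply: (C_sub_weight_ge hV ht T_gt0 hW n2); apply: hw.
have Em n m : (2 <= n)%N ->
    ((n - 2) * T * (T + 1) * 2 ^ (n - 2) * T)%N%:Z <= m -> 0 < m ->
    E_sub B m `<=` Wge n.
  case: n => [|[|q]] // _; rewrite !subSS subn0 => qm m0.
  exact: (E_sub_weight_ge hV ht hg T_gt0 hW (degree_bound T_gt0 qm m0)).
split=> //; first exact: (C_sub_weight_ge hV ht T_gt0 hW).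
rewrite capC; apply/seteqP; split=> [w hw /=|_ -> n _]; last exact: linspan0.
apply: (weight_ge_cap0 T_gt0 hW) => n n2.
(* The successor of the threshold is positive even for n = 2, where the threshold is 0. *)
apply: (Em n ((n - 2) * T * (T + 1) * 2 ^ (n - 2) * T).+1%N%:Z n2) => //.
  by rewrite lez_nat leqnSn.
exact: hw.
Qed.
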